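(* Let $0<a<1$ and $b>0$. For every $u>0$, $$\pi_{\rm RSB}(u;a,b)=\frac{1}{B(a,b)}\int_{(0,\infty)^3} e^{-vu}\,\frac{v^{x+y}e^{-v}}{\Gamma(x+y+1)}\,\frac{x^{-a}}{\Gamma(1-a)}\,\frac{y^{a+b-1}e^{-y}}{\Gamma(a+b)}\,dv\,dx\,dy =\int_{(0,\infty)^3}\mathrm{Ex}(u\mid v)\,\mathrm{Ga}(v\mid x+y,1)\,g(x,y)\,dv\,dx\,dy,$$ where $$g(x,y)=\frac{1}{B(a,b)\Gamma(1-a)\Gamma(a+b)}\,\frac{x^{-a}y^{a+b-1}e^{-y}}{x+y},\qquad x,y>0.$$
   Context: For $a,b>0$, the rescaled beta (RSB) density is $\pi_{\rm RSB}(u;a,b)=\frac{1}{B(a,b)}\frac{\{\log(1+u)\}^{a-1}}{1+u}\frac{1}{\{1+\log(1+u)\}^{a+b}}$ for $u>0$, where $B$ is the beta function. $\mathrm{Ex}(u\mid v)=ve^{-vu}$ denotes the exponential density with rate $v$, and $\mathrm{Ga}(v\mid\alpha,\beta)=\beta^\alpha v^{\alpha-1}e^{-\beta v}/\Gamma(\alpha)$ denotes the gamma density with shape $\alpha$ and rate $\beta$. *)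

(* Defs.v *)
From HB Require Import structures.
From mathcomp Require Import all_boot all_order all_algebra.
From mathcomp Require Import all_classical all_reals all_analysis.
Set Implicit Arguments. Unset Strict Implicit. Unset Printing Implicit Defensive.
Import Order.TTheory GRing.Theory Num.Theory.
Local Open Scope classical_set_scope.
Local Open Scope ring_scope.

Section defs.
Variable R : realType.
Notation mu := (@lebesgue_measure R).

Definition Gammaf (s : R) : R :=
  Rintegral mu `]0%R, +oo[ (fun t => t `^ (s - 1) * expR (- t)).

Definition Betaf (a b : R) : R :=
  Rintegral mu `]0%R, 1%R[ (fun t => t `^ (a - 1) * (1 - t) `^ (b - 1)).

Definition pi_RSB (a b u : R) : R :=
  (Betaf a b)^-1 * ((ln (1 + u)) `^ (a - 1) / (1 + u))
  / (1 + ln (1 + u)) `^ (a + b).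

Definition Ex (u v : R) : R := v * expR (- (v * u)).

Definition Ga (v al be : R) : R :=
  be `^ al * v `^ (al - 1) * expR (- (be * v)) / Gammaf al.

Definition g_mix (a b x y : R) : R :=
  (Betaf a b * Gammaf (1 - a) * Gammaf (a + b))^-1 *
  (x `^ (- a) * y `^ (a + b - 1) * expR (- y) / (x + y)).
End defs.

(* Main.v *)
(* For fixed (x, y) the v-integral of the gamma kernel is (1+u)^-(x+y+1). With
   L = ln (1+u) this is e^-L e^-(Lx) e^-(Ly), so the x- and y-integrals decouple
   into gamma kernels of rates L and 1+L, giving L^(a-1) and (1+L)^-(a+b). The
   second form of the mixture only rewrites Gamma (x+y+1) as (x+y) Gamma (x+y). *)
Require Import Defs.
From HB Require Import structures.
From mathcomp Require Import all_boot all_order all_algebra.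
From mathcomp Require Import all_classical all_reals all_analysis.
From mathcomp Require Import measurable_realfun ring.
Import Order.TTheory GRing.Theory Num.Theory.
Import numFieldNormedType.Exports.
Local Open Scope classical_set_scope.
Local Open Scope ring_scope.

(** * Explicit improper integrals of exponentials and powers *)

Lemma integral_expRM_cy (R : realType) (c a : R) (hc : 0 < c) :
  (\int[@lebesgue_measure R]_(x in `[a, +oo[) (expR (- (c * x)))%:E =
   (expR (- (c * a)) / c)%:E)%E.
Proof.
have cexp : continuous (fun x : R => expR (- (c * x))).
  move=> x; apply: continuous_comp; last exact: continuous_expR.
  by apply: continuousN; apply: continuousM => //; exact: cst_continuous.
rewrite (@ge0_continuous_FTC2y _ _ (fun x => - (c^-1 * expR (- (c * x)))) a 0).
- by rewrite -EFinB sub0r opprK mulrC.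
- by move=> x _; exact: expR_ge0.
- exact: continuous_subspaceT.
- rewrite (_ : 0 = - (c^-1 * 0)); last by rewrite mulr0 oppr0.
  apply: cvgN; apply: cvgMr.
  apply: (@cvg_comp _ _ _ (fun x => c * x) (fun z => expR (- z)) _
    (pinfty_nbhs R)); last exact: cvgr_expR.
  exact: gt0_cvgMry.
- by move=> x _; exact: ex_derive.
- by apply: cvg_at_right_filter; apply: cvgN; apply: cvgMr; exact: cexp.
- move=> x _; rewrite derive1E; apply: derive_val.
  apply: is_derive_eq; rewrite /GRing.scale/=.
  by field; rewrite gt_eqF.
Qed.

Lemma cvgr_powRN (R : realType) (s : R) (hs : 0 < s) :
  x `^ (- s) @[x --> +oo%R] --> (0 : R).
Proof.
apply/cvgrPdist_le => e e0; near=> x.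
(* The threshold is the solution of [x^(-s) = e]; beyond it the decreasing power stays below [e]. *)
have xe : e `^ (- s^-1) <= x by near: x; exact: nbhs_pinfty_ge.
rewrite sub0r normrN ger0_norm ?powR_ge0//.
have x0 : 0 < x by rewrite (lt_le_trans _ xe)// powR_gt0.
rewrite powRN -[leRHS]invrK lef_pV2 ?posrE ?powR_gt0 ?invr_gt0//.
apply: le_trans (ge0_ler_powR (ltW hs) _ _ xe); last 2 first.
- by rewrite nnegrE powR_ge0.
- by rewrite nnegrE ltW.
by rewrite -powRrM mulNr mulVf ?gt_eqF// powRN powRr1// ltW.
Unshelve. all: by end_near. Qed.

(** The antiderivative [-x^(-s)/s] vanishes at infinity. The exponent is written [-(s + 1)] because
    the inner integral in [Gammae_succ] leaves it in this form. *)
Lemma integral_powRN_cy (R : realType) (s : R) (hs : 0 < s) :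
  (\int[@lebesgue_measure R]_(x in `[1%R, +oo[) (x `^ (- (s + 1)))%:E =
   (s^-1)%:E)%E.
Proof.
have cpow (p x : R) : 0 < x -> {for x, continuous (fun x : R => x `^ p)}.
  move=> x0; apply: differentiable_continuous; apply/derivable1_diffP.
  by apply: derivable_powR; rewrite in_itv/= andbT.
have dpow (x : R) : 0 < x ->
    is_derive x 1 (fun x => - (s^-1 * x `^ (- s))) (x `^ (- (s + 1))).
  move=> x0; have ? := is_derive1_powR (- s) x0.
  apply: is_derive_eq; rewrite /GRing.scale/= opprD.
  by field; rewrite gt_eqF.
rewrite (@ge0_continuous_FTC2y _ _ (fun x => - (s^-1 * x `^ (- s))) 1 0).
- by rewrite -EFinB sub0r opprK powR1 mulr1.
- by move=> x _; exact: powR_ge0.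
- apply/continuous_within_itvcyP; split.
    move=> x; rewrite in_itv/= andbT => x1; apply: cpow.
    exact: lt_trans x1.
  by apply: cvg_at_right_filter; exact: cpow.
- rewrite (_ : 0 = - (s^-1 * 0)); last by rewrite mulr0 oppr0.
  apply: cvgN; apply: cvgMr.
  exact: cvgr_powRN.
- by move=> x x1; have ? := dpow x (lt_trans ltr01 x1); exact: ex_derive.
- by apply: cvg_at_right_filter; apply: cvgN; apply: cvgMr; exact: cpow.
- move=> x; rewrite in_itv/= andbT => x1; rewrite derive1E.
  by have ? := dpow x (lt_trans ltr01 x1); exact: derive_val.
Qed.

(** * Linear change of variables on the half-line *)

(** Lebesgue measure is [c] times its pushforward under [x |-> c x], and the integral against a
    pushforward is the integral of the composite. The half-line is its own preimage since
    [c > 0]. *)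
Lemma integral_scale_oy (R : realType) (c : R) (hc : 0 < c) (f : R -> \bar R)
    (mf : measurable_fun (`]0%R, +oo[%classic : set R) f)
    (f0 : forall x, 0 < x -> (0 <= f x)%E) :
  (\int[@lebesgue_measure R]_(x in `]0%R, +oo[) f (c * x)%R =
   (c^-1)%:E * \int[@lebesgue_measure R]_(x in `]0%R, +oo[) f x)%E.
Proof.
pose phi (x : measurableTypeR R) : measurableTypeR R := c * x.
have mphi : measurable_fun setT phi by exact: mulrl_measurable.
have c0 : 0 <= c by exact: ltW.
have [pm pmE] : exists pm : {measure set (measurableTypeR R) -> \bar R},
    forall A, pm A = pushforward (@lebesgue_measure R) phi A.
  by unshelve eexists (pushforward (@lebesgue_measure R) phi).
(* By uniqueness of Lebesgue measure it suffices to compare half-open intervals: [c] times the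
   length of []a/c, b/c]] is [b - a]. *)
have nuE A : measurable A ->
    (@lebesgue_measure R) A = mscale (NngNum c0) pm A.
  apply: lebesgue_measure_unique => _ [[a b] _ <-].
  rewrite /= /mscale/= pmE /pushforward.
  have -> : phi @^-1` `]a, b] = (`]a / c, b / c]%classic : set R).
    apply/seteqP; split => x /=;
      by rewrite !in_itv/= ltr_pdivrMr// ler_pdivlMr// mulrC.
  rewrite !lebesgue_measure_itv/= !lte_fin ltr_pM2r ?invr_gt0//.
  case: ifPn => _; last by rewrite mule0.
  rewrite -!EFinB -EFinM; congr EFin.
  by field; rewrite gt_eqF.
have f0' : {in `]0, +oo[%classic, forall x : R, (0 <= f x)%E}.
  by move=> x; rewrite inE/= in_itv/= andbT; exact: f0.
have -> : (\int[@lebesgue_measure R]_(x in `]0%R, +oo[) f x =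
    \int[mscale (NngNum c0) pm]_(x in `]0%R, +oo[) f x)%E.
  by apply: eq_measure_integral => A mA _; exact: nuE.
rewrite ge0_integral_mscale//; last first.
  by move=> x x0; apply: f0'; rewrite inE.
rewrite (@eq_measure_integral _ _ _ _ (pushforward (@lebesgue_measure R) phi) pm) //.
rewrite ge0_integral_pushforward// muleA -EFinM mulVf ?gt_eqF// mul1e.
congr (integral _ _ _).
by apply/seteqP; split => x /=; rewrite !in_itv/= !andbT pmulr_rgt0.
Qed.

(** * Measurability of variable powers, and Tonelli on rectangles *)

(** Follows the definition of [powR]: the indicator of a zero exponent when the base is zero,
    [exp (g ln f)] otherwise. Base and exponent both vary, as in [v^(x+y)]. *)
Lemma measurable_powR2 d (T : measurableType d) (R : realType) (f g : T -> R) :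
  measurable_fun setT f -> measurable_fun setT g ->
  measurable_fun setT (fun x => f x `^ g x).
Proof.
move=> mf mg; rewrite /powR; apply: measurable_fun_ifT.
- exact: measurable_fun_eqr.
- apply: (measurableT_comp (f := fun b : bool => b%:R : R)) => //.
  exact: measurable_fun_eqr.
- apply: (measurableT_comp (@measurable_expR R)).
  apply: measurable_funM => //.
  exact: (measurableT_comp (@measurable_ln R)).
Qed.

(** The function is extended by zero outside the rectangle, and Tonelli on the whole product is then
    restricted section by section. Both orders are stated so that the two iterated integrals can
    also be compared with each other. *)
Lemma tonelli_setX d1 d2 (T1 : measurableType d1) (T2 : measurableType d2)
    (R : realType) (m1 : {sigma_finite_measure set T1 -> \bar R})
    (m2 : {sigma_finite_measure set T2 -> \bar R}) (A : set T1) (B : set T2)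
    (f : T1 * T2 -> \bar R) :
  measurable A -> measurable B -> measurable_fun (A `*` B) f ->
  (forall x y, A x -> B y -> 0 <= f (x, y))%E ->
  (\int[m1 \x m2]_(z in A `*` B) f z = \int[m2]_(y in B) \int[m1]_(x in A) f (x, y) /\
   \int[m1 \x m2]_(z in A `*` B) f z = \int[m1]_(x in A) \int[m2]_(y in B) f (x, y))%E.
Proof.
move=> mA mB mf f0.
pose h := f \_ (A `*` B).
have mAB : measurable (A `*` B) by exact: measurableX.
have mh : measurable_fun setT h by apply/(measurable_restrictT f mAB).
have h0 z : (0 <= h z)%E.
  rewrite /h patchE; case: ifPn => //; rewrite inE.
  by case: z => x y [/= Ax By]; exact: f0.
have hE x y : h (x, y) = if (x \in A) && (y \in B) then f (x, y) else 0%E.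
  by rewrite /h patchE in_setX.
rewrite integral_mkcond; split.
- rewrite -/h fubini_tonelli2// [RHS]integral_mkcond; apply: eq_integral => y _.
  rewrite /fubini_G patchE; case: ifPn => yB; last first.
    by apply: integral0_eq => x _; rewrite hE (negbTE yB) andbF.
  rewrite [RHS]integral_mkcond; apply: eq_integral => x _.
  by rewrite hE yB andbT patchE.
- rewrite -/h fubini_tonelli1// [RHS]integral_mkcond; apply: eq_integral => x _.
  rewrite /fubini_F patchE; case: ifPn => xA; last first.
    by apply: integral0_eq => y _; rewrite hE (negbTE xA).
  rewrite [RHS]integral_mkcond; apply: eq_integral => y _.
  by rewrite hE xA patchE.
Qed.

(** * The extended Gamma integral: scaling and recursion *)

(* The extended-real Gamma integral: unlike Gammaf it does not collapse to 0 when
   divergent, so Tonelli applies to it before finiteness is known. *)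
Definition Gammae {R : realType} (s : R) : \bar R :=
  (\int[@lebesgue_measure R]_(t in `]0%R, +oo[) (t `^ (s - 1) * expR (- t))%:E)%E.

Lemma measurable_powR_expR (R : realType) (s c : R) :
  measurable_fun [set: R] (fun t : R => t `^ s * expR (- (c * t))).
Proof.
apply: measurable_funM; first exact: measurable_powR.
apply: (measurableT_comp (@measurable_expR R)).
by apply: measurableT_comp => //; exact: mulrl_measurable.
Qed.

Lemma Gammae_ge0 (R : realType) (s : R) : (0 <= Gammae s)%E.
Proof.
apply: integral_ge0 => t _.
by rewrite lee_fin mulr_ge0 ?powR_ge0 ?expR_ge0.
Qed.

(** Substituting [ct] for [t] gives [c^(1-s)] from the power and [c^(-1)] from the measure. The
    equality is between extended reals, hence usable before the integral is known to be finite. *)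
Lemma integral_powR_expR (R : realType) (s c : R) (hc : 0 < c) :
  (\int[@lebesgue_measure R]_(t in `]0%R, +oo[)
     (t `^ (s - 1) * expR (- (c * t)))%:E = (c `^ (- s))%:E * Gammae s)%E.
Proof.
pose f (t : R) := (t `^ (s - 1) * expR (- t))%:E.
have mf : measurable_fun (`]0%R, +oo[%classic : set R) f.
  apply: measurable_funTS; apply/measurable_EFinP.
  under eq_fun do rewrite -[X in expR (- X)]mul1r.
  exact: measurable_powR_expR.
have f0 t : 0 < t -> (0 <= f t)%E.
  by move=> _; rewrite lee_fin mulr_ge0 ?powR_ge0 ?expR_ge0.
transitivity (\int[@lebesgue_measure R]_(t in `]0%R, +oo[)
    ((c `^ (1 - s))%:E * f (c * t)%R))%E.
  apply: eq_integral => t; rewrite inE/= in_itv/= andbT => t0.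
  rewrite /f -EFinM; congr EFin; rewrite powRM ?ltW// !mulrA -powRD; last first.
    by rewrite (gt_eqF hc) implybT.
  by rewrite addrA subrK subrr powRr0 mul1r.
rewrite ge0_integralZl_EFin//; last 3 first.
- by move=> t; rewrite /= in_itv/= andbT => t0; rewrite f0// mulr_gt0.
- apply: measurable_funTS; apply/measurable_EFinP; rewrite /f/=.
  apply: measurable_funM; last first.
    apply: (measurableT_comp (@measurable_expR R)).
    by apply: measurableT_comp => //; exact: mulrl_measurable.
  apply: (measurableT_comp (measurable_powR _)).
  exact: mulrl_measurable.
- exact: powR_ge0.
rewrite integral_scale_oy// muleA -EFinM -(powR_inv1 (ltW hc)) -powRD; last first.
  by rewrite (gt_eqF hc) implybT.
by rewrite (_ : 1 - s + -1 = - s)//; ring.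
Qed.
Lemma mem_oy (R : realType) (t : R) : (t \in `]0%R, +oo[%classic) = (0 < t).
Proof. by apply/idP/idP; rewrite inE/= in_itv/= andbT. Qed.

Lemma measurable_expRM (R : realType) (c : R) (D : set R) :
  measurable_fun D (fun t : R => (expR (- (c * t)))%:E).
Proof.
apply: measurable_funTS; apply/measurable_EFinP.
apply: (measurableT_comp (@measurable_expR R)).
by apply: measurableT_comp => //; exact: mulrl_measurable.
Qed.

(* Integrate [t^s e^(-ct)] over c > 1 and t > 0 in both orders: the c-integral
   gives [t^(s-1) e^(-t)], the t-integral [c^-(s+1) Gamma (s+1)]. *)
Lemma Gammae_succ (R : realType) (s : R) (hs : 0 < s) :
  (Gammae s = (s^-1)%:E * Gammae (s + 1))%E.
Proof.
pose f (z : R * R) := (z.2 `^ (s + 1 - 1) * expR (- (z.1 * z.2)))%:E.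
pose A : set R := `[1%R, +oo[%classic; pose B : set R := `]0%R, +oo[%classic.
have mf : measurable_fun (A `*` B) f.
  apply: measurable_funTS; apply/measurable_EFinP; apply: measurable_funM.
    by apply: (measurableT_comp (measurable_powR _)); exact: measurable_snd.
  apply: (measurableT_comp (@measurable_expR R)).
  by apply: measurableT_comp => //; exact: measurable_funM.
(* The integral of [e^(-ct)] over [c >= 1] is [e^(-t)/t]; the division by [t] lowers the exponent
   from [s] to [s - 1]. *)
have tE (t : R) : 0 < t ->
    t `^ (s + 1 - 1) * (expR (- t) / t) = t `^ (s - 1) * expR (- t).
  move=> t0; rewrite addrK powRB; last by rewrite (gt_eqF t0) implybT.
  by rewrite (powRr1 (ltW t0)); ring.
have [] := @tonelli_setX _ _ _ _ R (@lebesgue_measure R) (@lebesgue_measure R)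
  A B f _ _ mf _.
- exact: measurable_itv.
- exact: measurable_itv.
- by move=> x y _ _; rewrite lee_fin mulr_ge0 ?powR_ge0 ?expR_ge0.
(* [fE] now equates the two iterated integrals of [f]. *)
move=> -> fE.
transitivity (\int[@lebesgue_measure R]_(y in `]0%R, +oo[)
    \int[@lebesgue_measure R]_(x in `[1%R, +oo[) f (x, y))%E.
  apply: eq_integral => t; rewrite mem_oy => t0; rewrite /f/=.
  under eq_integral do rewrite EFinM [_ * t]mulrC.
  rewrite ge0_integralZl_EFin; first last.
  - exact: powR_ge0.
  - exact: measurable_expRM.
  - by move=> x _; rewrite lee_fin expR_ge0.
  - exact: measurable_itv.
  rewrite integral_expRM_cy; last by [].
  by rewrite mulr1 -EFinM tE.
rewrite fE.
transitivity (\int[@lebesgue_measure R]_(x in `[1%R, +oo[)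
    ((x `^ (- (s + 1)))%:E * Gammae (s + 1)))%E.
  apply: eq_integral => x; rewrite /A inE/= in_itv/= andbT => x1.
  have x0 : 0 < x by rewrite (lt_le_trans ltr01).
  exact: integral_powR_expR.
rewrite ge0_integralZr.
- by rewrite integral_powRN_cy.
- exact: measurable_itv.
- apply: measurable_funTS; apply/measurable_EFinP; exact: measurable_powR.
- by move=> x _; rewrite lee_fin powR_ge0.
- exact: Gammae_ge0.
Qed.

(** * Finiteness, positivity, recursion and measurability of the real Gamma function *)

Lemma measurable_gamma_integrand (R : realType) (s : R) (D : set R) :
  measurable_fun D (fun t : R => (t `^ (s - 1) * expR (- t))%:E).
Proof.
apply: measurable_funTS; apply/measurable_EFinP.
under eq_fun do rewrite -[X in expR (- X)]mul1r.
exact: measurable_powR_expR.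
Qed.

(** Domination of [t^s e^(-t)] by [(2s)^s e^(-t/2)]. At the shifted argument the integrand has no
    singularity at 0, so a single exponential bound serves the whole half-line. *)
Lemma Gammae_succ_lty (R : realType) (s : R) (hs : 0 < s) :
  (Gammae (s + 1) < +oo)%E.
Proof.
have h0 : (0 : R) < 2^-1 by rewrite invr_gt0.
apply: (@le_lt_trans _ _ (\int[@lebesgue_measure R]_(t in `[0%R, +oo[)
    (((2 * s) `^ s)%:E * (expR (- (2^-1 * t)))%:E))%E); last first.
  rewrite ge0_integralZl_EFin; first last.
  - exact: powR_ge0.
  - exact: measurable_expRM.
  - by move=> x _; rewrite lee_fin expR_ge0.
  - exact: measurable_itv.
  by rewrite integral_expRM_cy// -EFinM ltry.
have mexp (D : set R) : measurable_fun D (fun t : R =>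
    (((2 * s) `^ s)%:E * (expR (- (2^-1 * t)))%:E))%E.
  by apply: measurable_funeM; exact: measurable_expRM.
(* The endpoint 0 is added to the domain to meet the closed interval of [integral_expRM_cy]. *)
apply: (@le_trans _ _ (\int[@lebesgue_measure R]_(t in `]0%R, +oo[)
    (((2 * s) `^ s)%:E * (expR (- (2^-1 * t)))%:E))%E); last first.
  apply: ge0_subset_integral => //.
  - exact: mexp.
  - by move=> x _; rewrite mule_ge0// lee_fin ?powR_ge0 ?expR_ge0.
  - by move=> x /=; rewrite !in_itv/= !andbT; exact: ltW.
apply: ge0_le_integral => //.
- by move=> x _; rewrite lee_fin mulr_ge0 ?powR_ge0 ?expR_ge0.
- exact: measurable_gamma_integrand.
- exact: mexp.
- move=> t; rewrite /= in_itv/= andbT => t0; rewrite -EFinM lee_fin addrK.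
  have s2 : 0 < 2 * s by rewrite mulr_gt0.
  rewrite (_ : - (2^-1 * t) = 2^-1 * t - t); last by field.
  rewrite expRD mulrA ler_wpM2r ?expR_ge0//.
  rewrite -[in leLHS](@divfK _ (2 * s) _ t) ?gt_eqF//.
  (* x <= e^x at x = t / 2s gives t^s <= (2s)^s e^(t/2). *)
  have ts0 : 0 <= t / (2 * s) by rewrite divr_ge0 ?ltW.
  rewrite (powRM _ ts0 (ltW s2)) [leLHS]mulrC ler_wpM2l ?powR_ge0//.
  apply: (@le_trans _ _ (expR (t / (2 * s)) `^ s)).
    apply: ge0_ler_powR; rewrite ?nnegrE ?expR_ge0 ?(ltW hs)//.
    by rewrite (le_trans _ (expR_ge1Dx _))// lerDr.
  rewrite /powR gt_eqF ?expR_gt0// expRK ler_expR.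
  rewrite (_ : s * (t / (2 * s)) = 2^-1 * t)//.
  by field; rewrite gt_eqF.
Qed.

(** On [[1, +oo[] the factor [t^s] is at least 1, so the integral is at least that of [e^(-t)]
    there, which is [e^(-1)]. *)
Lemma Gammae_succ_gt0 (R : realType) (s : R) (hs : 0 < s) :
  (0 < Gammae (s + 1))%E.
Proof.
apply: (@lt_le_trans _ _ (\int[@lebesgue_measure R]_(t in `[1%R, +oo[)
    (expR (- (1 * t)))%:E)%E).
  by rewrite integral_expRM_cy// lte_fin divr_gt0// expR_gt0.
apply: (@le_trans _ _ (\int[@lebesgue_measure R]_(t in `[1%R, +oo[)
    (t `^ (s + 1 - 1) * expR (- t))%:E)%E); last first.
  apply: ge0_subset_integral => //.
  - exact: measurable_gamma_integrand.
  - by move=> x _; rewrite lee_fin mulr_ge0 ?powR_ge0 ?expR_ge0.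
  - by move=> x /=; rewrite !in_itv/= !andbT; exact: lt_le_trans.
apply: ge0_le_integral => //.
- exact: measurable_expRM.
- exact: measurable_gamma_integrand.
- move=> t; rewrite /= in_itv/= andbT => t1; rewrite lee_fin mul1r addrK.
  by rewrite ler_peMl ?expR_ge0// -(powRr0 t) ler_powR// ltW.
Qed.

(** The recursion carries finiteness from [s + 1] down to [s], so [fine] loses nothing in the
    definition of [Gammaf]. *)
Lemma EFin_Gammaf (R : realType) (s : R) (hs : 0 < s) :
  (Gammaf s)%:E = Gammae s.
Proof.
rewrite /Gammaf /Rintegral -/(Gammae s) fineK//.
rewrite ge0_fin_numE ?Gammae_ge0// Gammae_succ// lte_mul_pinfty//.
- by rewrite lee_fin invr_ge0 ltW.
- exact: Gammae_succ_lty.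
Qed.

Lemma Gammaf_gt0 (R : realType) (s : R) (hs : 0 < s) : 0 < Gammaf s.
Proof.
rewrite -lte_fin EFin_Gammaf// Gammae_succ// mule_gt0 ?lte_fin ?invr_gt0//.
exact: Gammae_succ_gt0.
Qed.

Lemma Gammaf_succ (R : realType) (s : R) (hs : 0 < s) :
  Gammaf (s + 1) = s * Gammaf s.
Proof.
have s1 : 0 < s + 1 by rewrite addr_gt0.
apply: EFin_inj; rewrite EFinM (EFin_Gammaf _ _ s1) (EFin_Gammaf _ _ hs).
by rewrite (Gammae_succ _ _ hs) muleA -EFinM mulfV ?gt_eqF// mul1e.
Qed.

Lemma Gammaf_ge0 (R : realType) (s : R) : 0 <= Gammaf s.
Proof. by rewrite fine_ge0// Gammae_ge0. Qed.

(** Needed because [Gammaf (x + y + 1)] occurs in the mixture. [Gammaf] is [fine] of a parameter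
    integral of a nonnegative jointly measurable function, which Tonelli makes measurable in the
    parameter. *)
Lemma measurable_Gammaf (R : realType) : measurable_fun [set: R] (@Gammaf R).
Proof.
pose D : set (R * R) := [set: R] `*` `]0%R, +oo[%classic.
pose f (z : R * R) := (z.2 `^ (z.1 - 1) * expR (- z.2))%:E.
have mD : measurable D by exact: measurableX.
have mf : measurable_fun setT (f \_ D).
  apply/(measurable_restrictT f mD).
  apply: measurable_funTS; apply/measurable_EFinP; apply: measurable_funM.
    apply: measurable_powR2; first exact: measurable_snd.
    by apply: measurable_funB => //; exact: measurable_fst.
  apply: (measurableT_comp (@measurable_expR R)).
  by apply: measurableT_comp => //; exact: measurable_snd.
have f0 z : (0 <= (f \_ D) z)%E.
  rewrite patchE; case: ifPn => // _.
  by rewrite lee_fin mulr_ge0 ?powR_ge0 ?expR_ge0.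
have := measurable_fun_fubini_tonelli_F (m2 := @lebesgue_measure R) _ mf f0.
move=> mF; rewrite (_ : @Gammaf R = fine \o fubini_F (@lebesgue_measure R) (f \_ D)).
  by apply: measurableT_comp => //; exact: measurable_fine.
apply/funext => s; rewrite /Gammaf /Rintegral /=; congr fine.
rewrite /fubini_F [LHS]integral_mkcond; apply: eq_integral => t _.
by rewrite !patchE in_setX/= in_setT.
Qed.

(** * Gamma kernels and products of sigma-finite measures *)

(** This is the gamma density of shape [s] and rate [c] without its factor [c^s]. *)
Lemma integral_gamma_kernel (R : realType) (s c : R) (hs : 0 < s) (hc : 0 < c) :
  (\int[@lebesgue_measure R]_(t in `]0%R, +oo[)
     (t `^ (s - 1) * expR (- (c * t)) / Gammaf s)%:E = (c `^ (- s))%:E)%E.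
Proof.
under eq_integral do rewrite mulrC EFinM.
rewrite ge0_integralZl_EFin ?invr_ge0 ?Gammaf_ge0//; last 2 first.
- by move=> t _; rewrite lee_fin mulr_ge0 ?powR_ge0 ?expR_ge0.
- by apply: measurable_funTS; apply/measurable_EFinP; exact: measurable_powR_expR.
rewrite integral_powR_expR// -EFin_Gammaf// -!EFinM; congr EFin.
by field; rewrite gt_eqF// Gammaf_gt0.
Qed.
(* The library's sigma-finite instance on [m1 \x m2] is shadowed by the one for
   products of subprobabilities, so it has to be rebuilt. *)
Lemma product_measure1_sigma_finite d1 d2 (T1 : measurableType d1)
    (T2 : measurableType d2) (R : realType)
    (m1 : {sigma_finite_measure set T1 -> \bar R})
    (m2 : {sigma_finite_measure set T2 -> \bar R}) :
  exists m : {sigma_finite_measure set (T1 * T2)%type -> \bar R},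
    m = (m1 \x m2)%E :> (set (T1 * T2)%type -> \bar R).
Proof.
have sf : sigma_finite setT (m1 \x m2)%E.
  have /sigma_finiteP[F [TF ndF Foo]] := sigma_finiteT m1.
  have /sigma_finiteP[G [TG ndG Goo]] := sigma_finiteT m2.
  (* Both exhaustions increase, so a point with coordinates in [F i] and [G j] lies in the rectangle
     of index [max i j]. *)
  exists (fun n => F n `*` G n).
    rewrite -setXTT TF TG; apply/seteqP; split; last first.
      by move=> [x y] [n _ [/= Fx Gy]]; split; exists n.
    move=> [x y] [/= [i _ Fx] [j _ Gy]]; exists (maxn i j) => //=; split.
    - by move: x Fx; exact/subsetPset/ndF/leq_maxl.
    - by move: y Gy; exact/subsetPset/ndG/leq_maxr.
  move=> k; have [mF Fk] := Foo k; have [mG Gk] := Goo k.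
  split; first exact: measurableX.
  by rewrite product_measure1E// lte_mul_pinfty// ge0_fin_numE.
pose mixin := Measure_isSigmaFinite.Build _ _ _ (m1 \x m2)%E sf.
pose m : {sigma_finite_measure set (T1 * T2)%type -> \bar R} :=
  HB.pack (m1 \x m2)%E mixin.
by exists m.
Qed.

(** Here [k] collects the factors free of the current variable; each of the three integrations of
    the mixture has this form. *)
Lemma integral_gamma_kernelZ (R : realType) (k s c : R) (hk : 0 <= k)
    (hs : 0 < s) (hc : 0 < c) :
  (\int[@lebesgue_measure R]_(t in `]0%R, +oo[)
     (k * (t `^ (s - 1) * expR (- (c * t)) / Gammaf s))%:E =
   (k * c `^ (- s))%:E)%E.
Proof.
under eq_integral do rewrite EFinM.
rewrite ge0_integralZl_EFin//.
- by rewrite integral_gamma_kernel// EFinM.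
- move=> t _; rewrite lee_fin.
  by rewrite divr_ge0 ?mulr_ge0 ?powR_ge0 ?expR_ge0 ?Gammaf_ge0.
- apply: measurable_funTS; apply/measurable_EFinP.
  apply: measurable_funM => //; exact: measurable_powR_expR.
Qed.

(** * Evaluation of the mixture integral *)

(** Matches the integrand of the first representation term for term, so that results on it transfer
    to the theorem by conversion. *)
Definition mix_integrand {R : realType} (a b u : R) (p : R * R * R) : R :=
  let v := p.1.1 in let x := p.1.2 in let y := p.2 in
  expR (- (v * u)) *
  (v `^ (x + y) * expR (- v) / Gammaf (x + y + 1)) *
  (x `^ (- a) / Gammaf (1 - a)) *
  (y `^ (a + b - 1) * expR (- y) / Gammaf (a + b)).

Lemma mix_integrand_ge0 (R : realType) (a b u : R) (p : R * R * R) :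
  0 <= mix_integrand a b u p.
Proof.
by rewrite /mix_integrand/= !mulr_ge0 ?invr_ge0 ?expR_ge0 ?powR_ge0 ?Gammaf_ge0.
Qed.

Lemma measurable_mix_integrand (R : realType) (a b u : R) :
  measurable_fun setT (mix_integrand a b u).
Proof.
have mv : measurable_fun setT (fun p : R * R * R => p.1.1).
  by apply: measurableT_comp => //; exact: measurable_fst.
have mx : measurable_fun setT (fun p : R * R * R => p.1.2).
  by apply: (measurableT_comp measurable_snd); exact: measurable_fst.
have my : measurable_fun setT (fun p : R * R * R => p.2).
  exact: measurable_snd.
have mexp (f : R * R * R -> R) : measurable_fun setT f ->
    measurable_fun setT (fun p => expR (- f p)).
  move=> mf; apply: (measurableT_comp (@measurable_expR R)).
  exact: measurableT_comp.
rewrite /mix_integrand/=; repeat apply: measurable_funM => //.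
- by apply: mexp; exact: measurable_funM.
- by apply: measurable_powR2 => //; exact: measurable_funD.
- exact: mexp.
(* The inverse of a nonnegative number is a power with exponent [-1], which [measurable_powR2]
   covers. *)
- under eq_fun do rewrite -powR_inv1 ?Gammaf_ge0//.
  apply: measurable_powR2 => //.
  apply: (measurableT_comp (@measurable_Gammaf R)).
  by do 2 apply: measurable_funD => //.
- exact: measurable_powR2.
- exact: measurable_powR2.
- exact: mexp.
Qed.

(** Tonelli, applied twice, puts [v] innermost, then [x], then [y]. The gamma kernels have shapes
    [x + y + 1], [1 - a], [a + b] and rates [1 + u], [L], [1 + L]; all are positive by the
    hypotheses. *)
Lemma integral_mix_integrand (R : realType) (a b u : R)
    (ha0 : 0 < a) (ha1 : a < 1) (hb : 0 < b) (hu : 0 < u) :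
  (\int[((@lebesgue_measure R) \x (@lebesgue_measure R)) \x (@lebesgue_measure R)]_(p in
        (`]0%R, +oo[ `*` `]0%R, +oo[) `*` `]0%R, +oo[)
      (mix_integrand a b u p)%:E =
  ((ln (1 + u)) `^ (a - 1) / (1 + u) / (1 + ln (1 + u)) `^ (a + b))%:E)%E.
Proof.
set L := ln (1 + u).
have u1 : 0 < 1 + u by rewrite addr_gt0.
have L0 : 0 < L by rewrite ln_gt0// ltrDl.
have mE (D : set (R * R * R)) :
    measurable_fun D (fun p => (mix_integrand a b u p)%:E).
  apply: measurable_funTS; apply/measurable_EFinP.
  exact: measurable_mix_integrand.
have F0 p : (0 <= (mix_integrand a b u p)%:E)%E.
  by rewrite lee_fin mix_integrand_ge0.
pose P : set R := `]0%R, +oo[%classic.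
have mP : measurable P by exact: measurable_itv.
have mPP : measurable (P `*` P) by exact: measurableX.
(* [mm] is the planar measure with the sigma-finite structure that [tonelli_setX] asks of its first
   factor. *)
have [mm mmE] := @product_measure1_sigma_finite _ _ _ _ R (@lebesgue_measure R)
  (@lebesgue_measure R).
rewrite -mmE.
have [-> _] := @tonelli_setX _ _ _ _ R mm (@lebesgue_measure R)
  (P `*` P) P (fun p => (mix_integrand a b u p)%:E) mPP mP (mE _) (fun _ _ _ _ => F0 _).
(* What remains after [v] and [x]: the factor [e^(-Ly)] left by the [v]-integral joins [e^(-y)] and
   raises the rate to [1 + L]. *)
transitivity (\int[@lebesgue_measure R]_(y in P)
   (((1 + u)^-1 * L `^ (- (1 - a))) *
    (y `^ (a + b - 1) * expR (- ((1 + L) * y)) / Gammaf (a + b)))%:E)%E.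
  apply: eq_integral => y; rewrite mem_oy => y0.
  have mEy (D : set (R * R)) :
      measurable_fun D (fun z => (mix_integrand a b u (z, y))%:E).
    apply: measurable_funTS; apply: (measurableT_comp (mE setT)).
    exact: pair2_measurable.
  rewrite mmE.
  have [-> _] := @tonelli_setX _ _ _ _ R (@lebesgue_measure R)
    (@lebesgue_measure R) P P (fun z => (mix_integrand a b u (z, y))%:E) mP mP
    (mEy _) (fun _ _ _ _ => F0 _).
  pose Ky := y `^ (a + b - 1) * expR (- y) / Gammaf (a + b).
  have Ky0 : 0 <= Ky.
    by rewrite !mulr_ge0 ?invr_ge0 ?expR_ge0 ?powR_ge0 ?Gammaf_ge0.
  transitivity (\int[@lebesgue_measure R]_(x in P)
     (((1 + u)^-1 * expR (- (L * y)) * Ky) *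
      (x `^ (1 - a - 1) * expR (- (L * x)) / Gammaf (1 - a)))%:E)%E.
    apply: eq_integral => x; rewrite mem_oy => x0.
    pose Kx := x `^ (- a) / Gammaf (1 - a).
    have Kx0 : 0 <= Kx by rewrite divr_ge0 ?powR_ge0 ?Gammaf_ge0.
    transitivity (\int[@lebesgue_measure R]_(v in P)
       (Kx * Ky * (v `^ (x + y + 1 - 1) * expR (- ((1 + u) * v)) /
         Gammaf (x + y + 1)))%:E)%E.
      apply: eq_integral => v _; apply: (congr1 EFin); rewrite /mix_integrand addrK.
      rewrite (_ : - ((1 + u) * v) = - (v * u) + - v) ?expRD; last by ring.
      (* Powers, exponentials and Gamma values become variables, leaving [ring] a purely
         multiplicative identity. *)
      have mulE (e w f h k l : R) :
          e * (w * f / h) * k * l = k * l * (w * (e * f) / h) by ring.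
      exact: mulE.
    have K0 : 0 <= Kx * Ky by exact: mulr_ge0.
    have xy1 : 0 < x + y + 1 by rewrite !addr_gt0.
    rewrite (integral_gamma_kernelZ _ _ _ _ K0 xy1 u1); congr EFin.
    have -> : (1 + u) `^ (- (x + y + 1)) =
        (1 + u)^-1 * expR (- (L * y)) * expR (- (L * x)).
      rewrite /powR gt_eqF// -/L -[in RHS](lnK u1) -/L -expRN -!expRD.
      by congr expR; ring.
    by rewrite /Kx (_ : 1 - a - 1 = - a); ring.
  have K0 : 0 <= (1 + u)^-1 * expR (- (L * y)) * Ky.
    by rewrite mulr_ge0// mulr_ge0 ?expR_ge0// invr_ge0 ltW.
  have a1 : 0 < 1 - a by rewrite subr_gt0.
  rewrite (integral_gamma_kernelZ _ _ _ _ K0 a1 L0).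
  congr EFin; rewrite (_ : - ((1 + L) * y) = - (L * y) + - y) ?expRD; last by ring.
  by rewrite /Ky; ring.
have K0 : 0 <= (1 + u)^-1 * L `^ (- (1 - a)).
  by rewrite mulr_ge0 ?powR_ge0// invr_ge0 ltW.
have ab0 : 0 < a + b by rewrite addr_gt0.
have L1 : 0 < 1 + L by rewrite addr_gt0.
rewrite (integral_gamma_kernelZ _ _ _ _ K0 ab0 L1).
by rewrite opprB [in LHS]powRN [(1 + u)^-1 * _]mulrC.
Qed.

(* Points of (0,oo)^3 are ((v, x), y); the measure is Lebesgue^3 as a product measure. *)
Theorem theorem1 (R : realType) (a b : R) (ha0 : 0 < a) (ha1 : a < 1) (hb : 0 < b)
  (u : R) (hu : 0 < u) :
  ((pi_RSB a b u)%:E =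
    ((Betaf a b)^-1)%:E *
    \int[((@lebesgue_measure R) \x (@lebesgue_measure R)) \x (@lebesgue_measure R)]_(p in
        (`]0%R, +oo[ `*` `]0%R, +oo[) `*` `]0%R, +oo[)
      (let v := p.1.1 in let x := p.1.2 in let y := p.2 in
       expR (- (v * u)) *
       (v `^ (x + y) * expR (- v) / Gammaf (x + y + 1)) *
       (x `^ (- a) / Gammaf (1 - a)) *
       (y `^ (a + b - 1) * expR (- y) / Gammaf (a + b)))%:E)%E
  /\
  ((pi_RSB a b u)%:E =
    \int[((@lebesgue_measure R) \x (@lebesgue_measure R)) \x (@lebesgue_measure R)]_(p in
        (`]0%R, +oo[ `*` `]0%R, +oo[) `*` `]0%R, +oo[)
      (let v := p.1.1 in let x := p.1.2 in let y := p.2 in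
       Ex u v * Ga v (x + y) 1 * g_mix a b x y)%:E)%E.
Proof.
have mixE := @integral_mix_integrand R a b u ha0 ha1 hb hu.
have piE : ((pi_RSB a b u)%:E = ((Betaf a b)^-1)%:E *
    \int[((@lebesgue_measure R) \x (@lebesgue_measure R)) \x (@lebesgue_measure R)]_(p in
        (`]0%R, +oo[ `*` `]0%R, +oo[) `*` `]0%R, +oo[)
      (mix_integrand a b u p)%:E)%E.
  by rewrite mixE -EFinM; congr EFin; rewrite /pi_RSB !mulrA.
split; first exact: piE.
have B0 : 0 <= (Betaf a b)^-1.
  rewrite invr_ge0; apply: Rintegral_ge0 => t _.
  by rewrite mulr_ge0 ?powR_ge0.
rewrite piE -ge0_integralZl_EFin//; first last.
- apply: measurable_funTS; apply/measurable_EFinP.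
  exact: measurable_mix_integrand.
- by move=> p _; rewrite lee_fin mix_integrand_ge0.
- by do 2 apply: measurableX => //.
apply: eq_integral => -[[v x] y]; rewrite inE => -[[/= v0 x0] y0].
move: v0 x0 y0; rewrite !in_itv/= !andbT => v0 x0 y0.
rewrite -EFinM; congr EFin; rewrite /mix_integrand/= /Ex /Ga /g_mix powR1 !mul1r.
have xy0 : 0 < x + y by rewrite addr_gt0.
(* Splitting [v^(x+y)] as [v v^(x+y-1)] frees the rate factor of [Ex]; the factor [x + y] from the
   Gamma recursion becomes the denominator in [g_mix]. *)
rewrite (Gammaf_succ _ _ xy0) -(mulr_powRB1 (ltW v0) xy0).
have mulE (B e w f s G X G1 Y h G2 : R) :
    B^-1 * (e * (v * w * f / (s * G)) * (X / G1) * (Y * h / G2)) =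
    v * e * (w * f / G) * ((B * G1 * G2)^-1 * (X * Y * h / s)).
  by rewrite !invfM; ring.
exact: mulE.
Qed.
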